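(* If $B_1$ and $B_2$ are finite subsets of a vector space $V$ over a field whose characteristic is zero or odd, then $$|B_1^\ast+B_2^\ast|\ge\left(\tfrac83\right)^{(\operatorname{rk}(B_1)+\operatorname{rk}(B_2))/2}.$$ In particular, if $\dim V=n$ and $B_1,B_2$ are bases of $V$, then $|B_1^\ast+B_2^\ast|\ge(8/3)^n$.
   Context: For a subset $B$ of a vector space, $B^\ast=\{\sum_{a\in A}a: A\subseteq B,\ A\text{ finite}\}$ is its subset sum set (including the empty sum $0$), $\operatorname{rk}(B)$ is the dimension of the linear span of $B$, and $B_1^\ast+B_2^\ast=\{x+y:x\in B_1^\ast,\ y\in B_2^\ast\}$. *)

(* Defs.v *)
From mathcomp Require Import all_boot all_order all_algebra finmap.
From mathcomp Require Import boolp classical_sets reals exp.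

Set Implicit Arguments.
Unset Strict Implicit.
Unset Printing Implicit Defensive.

Import Order.TTheory GRing.Theory Num.Theory.

Local Open Scope classical_set_scope.
Local Open Scope fset_scope.
Local Open Scope ring_scope.

Definition subset_sums (V : zmodType) (B : {fset V}) : {fset V} :=
  [fset \sum_(a <- A) a | A : {fset V} in fpowerset B].

Definition sumset (V : zmodType) (X Y : {fset V}) : {fset V} :=
  [fset x + y | x in X, y in Y].

Section Dimension.
Variables (F : fieldType) (V : lmodType F).
Implicit Types (B C : {fset V}) (W : set V).

Definition lin_span B : set V :=
  [set v | exists c : V -> F, v = \sum_(b <- B) c b *: b].

Definition lin_indep B : Prop :=
  forall c : V -> F, \sum_(b <- B) c b *: b = 0 ->
  forall b, b \in B -> c b = 0.

Definition is_basis W B : Prop := lin_indep B /\ lin_span B = W.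

(* W is finite-dimensional, of dimension n. *)
Definition has_dim W (n : nat) : Prop :=
  exists2 B, is_basis W B & #|` B| = n.

(* The dimension of the span of B; the default value 0 of xget plays no role,
   by has_dim_rk. *)
Definition rk B : nat := xget 0%N [set n | has_dim (lin_span B) n].

Lemma lin_indep_leq B C :
  lin_indep B -> (forall b, b \in B -> lin_span C b) -> (#|` B| <= #|` C|)%N.
Proof.
move=> freeB BC; rewrite leqNgt; apply/negP => ltCB.
have [k kE] : exists k : V -> V -> F,
    forall b, b \in B -> b = \sum_(x <- C) k b x *: x.
  have /choice[k kE] : forall b, exists c : V -> F,
      b \in B -> b = \sum_(x <- C) c x *: x.
    move=> b; case: (boolP (b \in B)) => [/BC[c cE]|_]; first by exists c.
    by exists (fun=> 0).
  by exists k.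
pose M := \matrix_(i < #|` B|, j < #|` C|) k B`_i C`_j.
have : kermx M != 0.
  rewrite kermx_eq0 /row_free; apply/eqP => rM.
  by have := rank_leq_col M; rewrite rM leqNgt ltCB.
case/rowV0Pn => u /sub_kermxP uM /eqP; apply.
pose c b := if insub (index b B) is Some i then u 0 i else 0.
have cE (i : 'I_(#|` B|)) : c B`_i = u 0 i.
  rewrite /c index_uniq ?fset_uniq ?ltn_ord // insubT //= => lti.
  by congr (u 0 _); apply: val_inj.
have /freeB c0 : \sum_(b <- B) c b *: b = 0.
  rewrite (big_nth 0) big_mkord.
  transitivity (\sum_(i < #|` B|) \sum_(j < #|` C|) (u 0 i * M i j) *: C`_j).
    apply: eq_bigr => i _; rewrite cE.
    rewrite {1}(kE B`_i) ?mem_nth // (big_nth 0) big_mkord scaler_sumr.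
    by apply: eq_bigr => j _; rewrite scalerA mxE.
  rewrite exchange_big big1 //= => j _; rewrite -scaler_suml.
  by move/rowP: uM => /(_ j); rewrite !mxE => ->; rewrite scale0r.
by apply/rowP => i; rewrite -cE mxE c0 // mem_nth.
Qed.

Lemma lin_span_mem B b : b \in B -> lin_span B b.
Proof.
move=> bB; exists (fun x => (x == b)%:R).
rewrite (big_fsetD1 b) //= eqxx scale1r big_seq big1 ?addr0 // => x.
by rewrite !inE => /andP[/negPf-> _]; rewrite scale0r.
Qed.

Lemma has_dim_unique W m n : has_dim W m -> has_dim W n -> m = n.
Proof.
move=> [B [freeB BW] <-] [C [freeC CW] <-]; apply/eqP; rewrite eqn_leq.
by apply/andP; split; apply: lin_indep_leq => // x /lin_span_mem;
  rewrite BW CW.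
Qed.

Lemma has_dim_rk B : has_dim (lin_span B) (rk B).
Proof.
apply: (@xgetPex _ 0%N [set n | has_dim (lin_span B) n]) => /=.
suff [C CB] : exists C, is_basis (lin_span B) C by exists #|` C|, C.
move: {2}#|` B| (erefl #|` B|) => n; elim: n B => [|n IHn] B cardB.
  exists B; split=> // c _ b.
  by move/eqP: cardB; rewrite cardfs_eq0 => /eqP->; rewrite inE.
have [freeB|] := pselect (lin_indep B); first by exists B.
move=> /existsNP[c /not_implyP[c0 /existsNP[b /not_implyP[bB /eqP cb]]]].
have {}bE : b = \sum_(x <- B `\ b) (- (c b)^-1 * c x) *: x.
  move: c0; rewrite (big_fsetD1 b) //= => /eqP; rewrite addr_eq0 => /eqP cbE.
  under eq_bigr do rewrite -scalerA.
  by rewrite -scaler_sumr scaleNr -scalerN -cbE scalerA mulVf // scale1r.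
have [|C [freeC CB]] := IHn (B `\ b).
  by move: (cardfsD1 b B); rewrite bB cardB => -[].
exists C; split=> //; rewrite CB; apply/seteqP; split=> v [d ->].
  exists (fun x => if x == b then 0 else d x).
  rewrite [RHS](big_fsetD1 b) //= eqxx scale0r add0r.
  by apply: eq_big_seq => x; rewrite !inE => /andP[/negPf->].
exists (fun x => d b * (- (c b)^-1 * c x) + d x).
rewrite (big_fsetD1 b) //= {2}bE scaler_sumr -big_split /=.
by apply: eq_bigr => x _; rewrite scalerDl scalerA.
Qed.

End Dimension.

(* Main.v *)
(* We may take B1 and B2 linearly independent, of sizes m and n, with sets of
   subset sums S1 and S2.  With E(X, Y) the number of solutions of
   x - x' = y - y' in X and Y, Cauchy-Schwarz gives
   (2^m 2^n)^2 <= |S1 + S2| E(S1, S2) and E(S1, S2)^2 <= E(S1, S1) E(S2, S2).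
   By independence, the last two factors are 6^m and 6^n: coordinatewise one
   counts the solutions of a - a' = b - b' in {0, 1}.  In characteristic 2 this
   count would be 8, not 6. *)
Require Import Defs.
From mathcomp Require Import all_boot all_order all_algebra finmap.
From mathcomp Require Import boolp classical_sets reals exp.

Set Implicit Arguments.
Unset Strict Implicit.
Unset Printing Implicit Defensive.

Import Order.TTheory GRing.Theory Num.Theory.
Local Open Scope classical_set_scope.
Local Open Scope fset_scope.
Local Open Scope ring_scope.

(** Cauchy-Schwarz without subtraction: once doubled, both sides are double sums over [i] and [j],
    and they compare termwise by 2ab <= a^2 + b^2 with a = [x j * y i] and b = [x i * y j]. *)
Lemma sqr_sum_muln_le (I : Type) (s : seq I) (x y : I -> nat) :
  ((\sum_(i <- s) x i * y i) ^ 2 <=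
     (\sum_(i <- s) x i ^ 2) * (\sum_(i <- s) y i ^ 2))%N.
Proof.
rewrite -(@leq_pmul2l 2) // -mulnn !big_distrlr /= [leqRHS]mul2n -addnn.
rewrite [X in (_ <= X + _)%N]exchange_big /= -big_split big_distrr /=.
apply: leq_sum => i _.
rewrite big_distrr -big_split /=; apply: leq_sum => j _.
have := (nat_Cauchy (x j * y i) (x i * y j)).1.
rewrite !expnMn => H; apply: leq_trans H.
by rewrite [in leqRHS]mulnACA [(x j * x i)%N]mulnC mulnACA.
Qed.

(** Families rather than sets, so that multiplicities count; for families of differences this is the
    energy E. *)
Definition collisions (T : eqType) (I J : finType) (u : I -> T) (v : J -> T) :
  nat := (\sum_i \sum_j (u i == v j))%N.

(** Grouping the pairs by their common value turns the count into an inner product of fibre sizes,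
    ready for Cauchy-Schwarz. *)
Lemma collisions_fiberwise (T : eqType) (s : seq T) (I J : finType)
    (u : I -> T) (v : J -> T) :
  uniq s -> (forall i, u i \in s) ->
  collisions u v =
    (\sum_(t <- s) (\sum_i (u i == t)) * (\sum_j (v j == t)))%N.
Proof.
move=> s_uniq us.
rewrite [RHS](eq_bigr (fun t =>
  \sum_i \sum_j (u i == t) * (v j == t))%N); last first.
  by move=> t _; rewrite big_distrlr.
rewrite exchange_big; apply: eq_bigr => i _.
rewrite exchange_big; apply: eq_bigr => j _ /=.
rewrite (bigD1_seq (u i)) //= eqxx mul1n eq_sym big1 ?addn0 // => t.
by rewrite eq_sym => /negPf ->.
Qed.

Lemma sqr_collisions_le (T : eqType) (I J : finType) (u : I -> T) (v : J -> T) :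
  (collisions u v ^ 2 <= collisions u u * collisions v v)%N.
Proof.
pose s := undup (codom u ++ codom v).
have us i : u i \in s by rewrite mem_undup mem_cat codom_f.
have vs j : v j \in s by rewrite mem_undup mem_cat codom_f orbT.
rewrite !(collisions_fiberwise _ (undup_uniq _) us).
by rewrite (collisions_fiberwise _ (undup_uniq _) vs) sqr_sum_muln_le.
Qed.

Lemma sqr_card_le_collisions (T : choiceType) (X : {fset T}) (I : finType)
    (u : I -> T) :
  (forall i, u i \in X) -> (#|I| ^ 2 <= collisions u u * #|` X|)%N.
Proof.
move=> uX.
have inj (x : X) :
    (\sum_(y : X) ((val x == val y) : nat) = 1)%N.
  rewrite (bigD1 x) //= eqxx big1 // => y.
  by rewrite (inj_eq val_inj) eq_sym => /negPf->.
have := sqr_collisions_le u (val : X -> T).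
have -> : collisions (val : X -> T) (val : X -> T) = #|` X|.
  rewrite /collisions (eq_bigr (fun=> 1%N)) => [|x _]; last exact: inj.
  by rewrite sum1_card -cardfE.
have -> // : collisions u (val : X -> T) = #|I|.
rewrite /collisions (eq_bigr (fun=> 1%N)) ?sum1_card // => i _.
exact: (inj [` uX i]).
Qed.

(** Distinct numbers among 0, 1, 2 differ by 1 or 2 up to sign, and both are nonzero in [F]. This is
    where characteristic 2 is excluded. *)
Lemma natr_inj_le2 (F : fieldType) (m n : nat) :
  2%:R != 0 :> F -> (m <= 2)%N -> (n <= 2)%N -> m%:R = n%:R :> F -> m = n.
Proof.
move=> F2; have F1 := oner_neq0 F.
have F21 : 2%:R != 1 :> F by rewrite mulr2n -subr_eq0 addrK.
by case: m n => [|[|[|m]]] [|[|[|n]]] //= _ _ /eqP;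
  rewrite ?(negPf F2, negPf F1, negPf F21) // eq_sym
    ?(negPf F2, negPf F1, negPf F21).
Qed.

Section CubeSum.
Variables (F : fieldType) (V : lmodType F).
Implicit Types B : {fset V}.

(** Subsets are encoded as 0-1 vectors, so that equations between sums can be read
    coordinatewise. *)
Definition cube_sum B (x : {ffun B -> bool}) : V :=
  \sum_(b : B) (x b)%:R *: val b.

Lemma cube_sum_subset_sums B (x : {ffun B -> bool}) :
  cube_sum x \in subset_sums B.
Proof.
pose P v := oapp x false (insub v).
apply/imfsetP; exists [fset v in B | P v] => /=.
  by rewrite fpowersetE; apply: fset_sub.
rewrite big_fset big_seq_fsetE [RHS]big_mkcond; apply: eq_bigr => b _.
by rewrite /P valK /=; case: (x b); rewrite ?scale1r ?scale0r.
Qed.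

Lemma lin_indep_fin B (d : B -> F) :
  lin_indep B -> \sum_(b : B) d b *: val b = 0 -> forall b, d b = 0.
Proof.
move=> freeB d0 b; pose c v := if insub v is Some b then d b else 0.
have cE (b' : B) : c (val b') = d b' by rewrite /c valK.
rewrite -cE; apply: freeB (valP b); rewrite big_seq_fsetE -[RHS]d0.
by apply: eq_bigr => b' _; rewrite cE.
Qed.

Definition cube_diff B (x : {ffun B -> bool} * {ffun B -> bool}) : V :=
  cube_sum x.1 - cube_sum x.2.

Lemma collisions_cube_diff_le B : 2%:R != 0 :> F -> lin_indep B ->
  (collisions (@cube_diff B) (@cube_diff B) <= 6 ^ #|` B|)%N.
Proof.
move=> F2 freeB.
(* The equation a - a' = b - b' with the negative terms moved across, so that it lives in [nat] with
   both sides at most 2. The values 0, 1, 2 are attained in 1, 2, 1 ways on each side, giving 1 + 4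
   + 1 = 6 solutions. *)
pose P := [pred t : (bool * bool) * (bool * bool) |
  (t.1.1 + t.2.2 == t.2.1 + t.1.2)%N].
have P6 : #|P| = 6%N.
  rewrite -sum1_card big_mkcond /=.
  transitivity (\sum_a \sum_a' \sum_b \sum_b'
    (((a : bool) + (b' : bool) == (b : bool) + (a' : bool)) : nat))%N.
    rewrite pair_bigA /= [RHS](eq_bigr _ (fun p _ => pair_bigA _ _)) pair_bigA.
    by apply: eq_bigr => t _; rewrite inE; case: eqP.
  by rewrite !big_bool.
pose I := ({ffun B -> bool} * {ffun B -> bool})%type.
(* Transposition: four 0-1 vectors become one vector of quadruples. It maps collisions injectively
   into the functions with all values in [P]. *)
pose h (p : I * I) : {ffun B -> (bool * bool) * (bool * bool)} :=
  [ffun b => ((p.1.1 b, p.1.2 b), (p.2.1 b, p.2.2 b))].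
have h_inj : injective h.
  move=> [[x x'] [y y']] [[z z'] [t t']] /ffunP hE.
  by congr (_, _, (_, _)); apply/ffunP => b; have := hE b;
    rewrite !ffunE => -[].
rewrite /collisions pair_bigA /=.
have -> : (\sum_(p : I * I) (cube_diff p.1 == cube_diff p.2) =
    #|[pred p : I * I | cube_diff p.1 == cube_diff p.2]|)%N.
  rewrite -sum1_card [RHS]big_mkcond; apply: eq_bigr => p _.
  by rewrite inE; case: eqP.
rewrite -(card_imset _ h_inj) cardfE -P6 -card_ffun_on.
apply: subset_leq_card.
apply/fintype.subsetP => _ /imsetP[[[x x'] [y y']] /eqP + ->].
rewrite /cube_diff /= => E; apply/ffun_onP => b; rewrite ffunE inE /=.
apply/eqP; apply: (natr_inj_le2 F2).
- by case: (x b); case: (y' b).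
- by case: (y b); case: (x' b).
apply/eqP; rewrite !natrD -subr_eq0.
apply/eqP; move: b; apply: (lin_indep_fin freeB).
transitivity (cube_sum x - cube_sum x' - (cube_sum y - cube_sum y'));
  last by rewrite E subrr.
rewrite -!sumrB; apply: eq_bigr => b _; rewrite -!scalerBl; congr (_ *: _).
by rewrite opprD opprB [RHS]addrACA; congr (_ + _); apply: addrC.
Qed.

End CubeSum.

(** The bound (2^(m+n))^2 <= E |X| is squared once more to use E^2 <= 6^(m+n); hence 16 = 2^4, and
    no roots are needed. *)
Lemma lin_indep_sumset_card (F : fieldType) (V : lmodType F) (B C : {fset V}) :
  2%:R != 0 :> F -> lin_indep B -> lin_indep C ->
  (16 ^ (#|` B| + #|` C|) <= 6 ^ (#|` B| + #|` C|) *
     #|` sumset (subset_sums B) (subset_sums C)| ^ 2)%N.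
Proof.
move=> F2 freeB freeC; set X := sumset _ _.
pose s (x : {ffun B -> bool} * {ffun C -> bool}) := cube_sum x.1 + cube_sum x.2.
have sX x : s x \in X.
  apply/imfset2P; exists (cube_sum x.1); rewrite ?cube_sum_subset_sums //.
  by exists (cube_sum x.2); rewrite ?cube_sum_subset_sums.
(* x + y = x' + y' is regrouped as x - x' = -(y - y'), so collisions of sums become collisions of
   differences. The sign does not affect the collisions of [dC] with itself. *)
pose dC (x : {ffun C -> bool} * {ffun C -> bool}) := - cube_diff x.
have sd : collisions s s = collisions (@cube_diff _ _ B) dC.
  transitivity (\sum_i \sum_j \sum_i' \sum_j' (s (i, j) == s (i', j')))%N.
    rewrite [RHS]pair_bigA; apply: eq_bigr => -[i j] _.
    by rewrite [RHS]pair_bigA; apply: eq_bigr => -[].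
  transitivity (\sum_i \sum_i' \sum_j \sum_j'
      (@cube_diff _ _ B (i, i') == dC (j, j')))%N; last first.
    rewrite [LHS]pair_bigA; apply: eq_bigr => -[i i'] _.
    by rewrite [LHS]pair_bigA; apply: eq_bigr => -[].
  apply: eq_bigr => i _; rewrite exchange_big; apply: eq_bigr => i' _.
  apply: eq_bigr => j _; apply: eq_bigr => j' _.
  rewrite /s /dC /cube_diff /= opprB; congr nat_of_bool.
  by rewrite subr_eq addrAC eq_sym [RHS]eq_sym subr_eq [_ + cube_sum j']addrC.
have dCE : collisions dC dC = collisions (@cube_diff _ _ C) (@cube_diff _ _ C).
  by apply: eq_bigr => x _; apply: eq_bigr => y _; rewrite eqr_opp.
have sXE := sqr_card_le_collisions sX.
have sE : (collisions s s ^ 2 <= 6 ^ (#|` B| + #|` C|))%N.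
  rewrite sd expnD; apply: leq_trans (sqr_collisions_le _ _) _.
  by rewrite dCE leq_mul ?collisions_cube_diff_le.
move: sXE; rewrite card_prod !card_ffun card_bool -!cardfE -expnD -leq_sqr.
rewrite expnMn -[X in (X ^ 2 <= _)%N -> _]expnM -expnM -mulnA mulnC expnM.
by move=> /leq_trans; apply; rewrite leq_mul2r sE orbT.
Qed.

Lemma subset_sumsS (V : zmodType) (B C : {fset V}) :
  B `<=` C -> subset_sums B `<=` subset_sums C.
Proof.
move=> BC; apply/fsubsetP => _ /imfsetP[A /= AB ->].
apply/imfsetP; exists A => //=; move: AB; rewrite !fpowersetE => AB.
exact: fsubset_trans BC.
Qed.

Lemma sumsetS (V : zmodType) (A B C D : {fset V}) :
  A `<=` B -> C `<=` D -> sumset A C `<=` sumset B D.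
Proof.
move=> /fsubsetP AB /fsubsetP CD.
apply/fsubsetP => _ /imfset2P[x /AB xB [y /CD yD ->]].
by apply/imfset2P; exists x => //; exists y.
Qed.

Lemma lin_indep_subset_rk (F : fieldType) (V : lmodType F) (B : {fset V}) :
  exists C : {fset V}, [/\ C `<=` B, lin_indep C & #|` C| = rk B].
Proof.
have [n] := ubnP #|` B|; elim: n B => // n IHn B ltBn.
have [freeB|/existsNP[c]] := pselect (lin_indep B).
  exists B; split=> //; apply: has_dim_unique (has_dim_rk B).
  by exists B.
move=> /not_implyP[c0 /existsNP[b /not_implyP[bB /eqP cb]]].
have spanE : lin_span (B `\ b) = lin_span B.
  apply/seteqP; split=> v [d ->].
    exists (fun x => if x == b then 0 else d x).
    rewrite [RHS](big_fsetD1 b) //= eqxx scale0r add0r.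
    by apply: eq_big_seq => x; rewrite !inE => /andP[/negPf->].
  (* Subtracting the multiple of the relation that cancels the coefficient
     of b. *)
  exists (fun x => d x - d b / c b * c x).
  transitivity (\sum_(x <- B) (d x - d b / c b * c x) *: x); last first.
    by rewrite (big_fsetD1 b) //= divfK // subrr scale0r add0r.
  under [RHS]eq_bigr do rewrite scalerBl -scalerA.
  by rewrite sumrB -scaler_sumr c0 scaler0 subr0.
have [|C [CB freeC cardC]] := IHn (B `\ b).
  by move: ltBn; rewrite (cardfsD1 b B) bB.
exists C; split=> //; first exact: fsubset_trans CB (fsubD1set _ _).
by rewrite cardC /rk spanE.
Qed.

Lemma two_neq0 (F : fieldType) :
  ([pchar F] =i pred0 \/ exists2 p : nat, p \in [pchar F] & odd p) ->
  2%:R != 0 :> F.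
Proof.
case=> [F0|[p Fp p_odd]]; apply/negP => F2.
  by have := F0 2%N; rewrite !inE F2.
have : 2%N \in [pchar F] by rewrite inE /= F2.
by rewrite (pcharf_eq Fp) inE => /eqP E; rewrite -E in p_odd.
Qed.

Theorem theorem3 (R : realType) (F : fieldType)
    (hF : [pchar F] =i pred0 \/ exists2 p : nat, p \in [pchar F] & odd p)
    (V : lmodType F) :
  (forall B1 B2 : {fset V},
     (8%:R / 3%:R : R) `^ ((rk B1 + rk B2)%:R / 2%:R)
       <= #|` sumset (subset_sums B1) (subset_sums B2)|%:R) /\
  (forall (n : nat) (B1 B2 : {fset V}),
     has_dim [set: V] n -> is_basis [set: V] B1 -> is_basis [set: V] B2 ->
     (8%:R / 3%:R : R) ^+ n
       <= #|` sumset (subset_sums B1) (subset_sums B2)|%:R).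
Proof.
have F2 := two_neq0 hF.
have main (B1 B2 : {fset V}) : (8%:R / 3%:R : R) `^ ((rk B1 + rk B2)%:R / 2%:R)
    <= #|` sumset (subset_sums B1) (subset_sums B2)|%:R.
  have [C1 [CB1 free1 <-]] := lin_indep_subset_rk B1.
  have [C2 [CB2 free2 <-]] := lin_indep_subset_rk B2.
  set X := sumset _ _; set m := (_ + _)%N.
  (* Squaring removes the half in the exponent; multiplying by [6 ^+ m] then clears the denominator,
     since 8/3 = 16/6, and leaves an inequality in [nat]. *)
  rewrite -(@ler_pXn2r _ 2) ?nnegrE ?powR_ge0 // -powR_mulrn ?powR_ge0 //.
  rewrite -powRrM divfK ?pnatr_eq0 // powR_mulrn ?divr_ge0 //.
  rewrite -(@ler_pM2l _ (6 ^+ m)) ?exprn_gt0 // -exprMn.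
  have -> : 6 * (8 / 3) = 16%:R :> R.
    by rewrite mulrA -natrM -[(6 * 8)%N]/(16 * 3)%N natrM mulfK ?pnatr_eq0.
  rewrite -!natrX -natrM ler_nat.
  apply: leq_trans (lin_indep_sumset_card F2 free1 free2) _.
  rewrite leq_mul2l leq_sqr; apply/orP; right; apply: fsubset_leq_card.
  by apply: sumsetS; apply: subset_sumsS.
split=> // n B1 B2 dimV [_ span1] [_ span2].
have rkE B : lin_span B = [set: V] -> rk B = n.
  by move=> BV; have := has_dim_rk B; rewrite BV => /has_dim_unique; apply.
have := main B1 B2; rewrite !rkE // addnn -muln2 natrM mulfK ?pnatr_eq0 //.
by rewrite powR_mulrn ?divr_ge0.
Qed.
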